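(* The linear maps $\Psi_{(\mathrm{ides},\mathrm{icomaj})}\colon\mathbf{FQSym}\to\mathbb{Q}[[t*,q,x]]$, $\Psi_{\mathrm{ipk}}\colon\mathbf{FQSym}\to\mathbb{Q}[[t*,x]]$ and $\Psi_{\mathrm{ilpk}}\colon\mathbf{FQSym}\to\mathbb{Q}[[t*,x]]$ defined for $\pi\in\mathfrak{S}_n$ by \[ \Psi_{(\mathrm{ides},\mathrm{icomaj})}(\mathbf{G}_{\pi})=\begin{cases}\dfrac{t^{\operatorname{ides}(\pi)+1}q^{\operatorname{icomaj}(\pi)}}{\prod_{i=0}^{n}(1-tq^{i})}x^{n}, & n\geq1,\\ 1/(1-t), & n=0,\end{cases} \] \[ \Psi_{\mathrm{ipk}}(\mathbf{G}_{\pi})=\begin{cases}\dfrac{2^{2\operatorname{ipk}(\pi)+1}t^{\operatorname{ipk}(\pi)+1}(1+t)^{n-2\operatorname{ipk}(\pi)-1}}{(1-t)^{n+1}}x^{n}, & n\geq1,\\ 1/(1-t), & n=0,\end{cases} \] \[ \Psi_{\mathrm{ilpk}}(\mathbf{G}_{\pi})=\frac{2^{2\operatorname{ilpk}(\pi)}t^{\operatorname{ilpk}(\pi)}(1+t)^{n-2\operatorname{ilpk}(\pi)}}{(1-t)^{n+1}}x^{n} \] are $\mathbb{Q}$-algebra homomorphisms.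
   Context: $\mathfrak{S}_n$ is the set of permutations of $[n]$ in one-line notation, $\mathfrak{S}=\bigsqcup_{n\ge0}\mathfrak{S}_n$. For a word $w$ of positive integers, $\operatorname{std}(w)$ replaces the letters by $1,2,\dots$ in order of size, equal letters regarded as increasing left to right. With noncommuting variables $X_1,X_2,\dots$, $\mathbf{G}_\pi=\sum\mathbf{X}$ over monomials $\mathbf{X}=X_{i_1}\cdots X_{i_n}$ with $\operatorname{std}(i_1\cdots i_n)=\pi$; $\mathbf{FQSym}$ is the $\mathbb{Q}$-algebra with basis $\{\mathbf{G}_\pi\}$ (product $\mathbf{G}_\pi\mathbf{G}_\sigma=\sum_{\tau\in C(\pi,\sigma)}\mathbf{G}_\tau$, $C(\pi,\sigma)$ the set of $\tau\in\mathfrak{S}_{m+n}$ whose first $m$ letters standardize to $\pi\in\mathfrak{S}_m$ and last $n$ letters to $\sigma\in\mathfrak{S}_n$). Statistics: for $\pi\in\mathfrak{S}_n$, $i\in[n-1]$ is a descent if $\pi_i>\pi_{i+1}$; $\operatorname{des}(\pi)$ is the number of descents, $\operatorname{comaj}(\pi)=\sum_{i\text{ descent}}(n-i)$; $i\in\{2,\dots,n-1\}$ is a peak if $\pi_{i-1}<\pi_i>\pi_{i+1}$, $\operatorname{pk}(\pi)$ is the number of peaks; $\operatorname{lpk}(\pi)$ is the number of peaks plus $1$ if $\pi_1>\pi_2$ (with $n\ge2$). For a statistic $\mathrm{st}$, $\mathrm{ist}(\pi)=\mathrm{st}(\pi^{-1})$, giving $\operatorname{ides},\operatorname{icomaj},\operatorname{ipk},\operatorname{ilpk}$.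 $\mathbb{Q}[[t*,q,x]]$ denotes formal power series in $t,q,x$ whose multiplication is ordinary in $q,x$ but the Hadamard product in $t$: $(\sum_n a_nt^n)*(\sum_n b_nt^n)=\sum_n a_nb_nt^n$ with $a_n,b_n\in\mathbb{Q}[[q,x]]$; its identity is $1/(1-t)$. $\mathbb{Q}[[t*,x]]$ is defined analogously. *)

(* Defs.v *)
From HB Require Import structures.
From mathcomp Require Import all_boot all_order all_algebra all_fingroup.
From mathcomp Require Import boolp finmap.
From mathcomp Require Import monalg.

Set Implicit Arguments.
Unset Strict Implicit.
Unset Printing Implicit Defensive.

Import GRing.Theory.
Local Open Scope ring_scope.

(* Formal power series in one variable; iterating the construction gives
   several variables, e.g. Q[[x]][[q]] = Q[[q, x]]. *)
Record fps (R : Type) := Fps { coefs : nat -> R }.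

Lemma fpsP (R : Type) (f g : fps R) : (forall n, coefs f n = coefs g n) -> f = g.
Proof. by case: f g => [f] [g] /= /funext ->. Qed.

HB.instance Definition _ (R : Type) := gen_eqMixin (fps R).
HB.instance Definition _ (R : Type) := gen_choiceMixin (fps R).

Section FpsZmodule.
Variable R : zmodType.
Implicit Types f g : fps R.

Definition fps_zero : fps R := Fps (fun=> 0).
Definition fps_opp f := Fps (fun n => - coefs f n).
Definition fps_add f g := Fps (fun n => coefs f n + coefs g n).

Fact fps_addA : associative fps_add.
Proof. by move=> f g h; apply: fpsP => n /=; rewrite addrA. Qed.
Fact fps_addC : commutative fps_add.
Proof. by move=> f g; apply: fpsP => n /=; rewrite addrC. Qed.
Fact fps_add0 : left_id fps_zero fps_add.
Proof. by move=> f; apply: fpsP => n /=; rewrite add0r. Qed.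
Fact fps_addN : left_inverse fps_zero fps_opp fps_add.
Proof. by move=> f; apply: fpsP => n /=; rewrite addNr. Qed.

HB.instance Definition _ :=
  GRing.isZmodule.Build (fps R) fps_addA fps_addC fps_add0 fps_addN.

Lemma coefs0 n : coefs (0 : fps R) n = 0. Proof. by []. Qed.
Lemma coefsN f n : coefs (- f) n = - coefs f n. Proof. by []. Qed.
Lemma coefsD f g n : coefs (f + g) n = coefs f n + coefs g n. Proof. by []. Qed.
Lemma coefsB f g n : coefs (f - g) n = coefs f n - coefs g n. Proof. by []. Qed.
Lemma coefs_sum I (r : seq I) (P : pred I) (F : I -> fps R) n :
  coefs (\sum_(i <- r | P i) F i) n = \sum_(i <- r | P i) coefs (F i) n.
Proof. exact: (big_morph (fun f : fps R => coefs f n)). Qed.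
End FpsZmodule.

Section FpsLmodule.
Variables (K : pzRingType) (V : lmodType K).
Implicit Types f g : fps V.

Definition fps_scale (a : K) f := Fps (fun n => a *: coefs f n).

Fact fps_scaleA a b f : fps_scale a (fps_scale b f) = fps_scale (a * b) f.
Proof. by apply: fpsP => n /=; rewrite scalerA. Qed.
Fact fps_scale1 : left_id 1 fps_scale.
Proof. by move=> f; apply: fpsP => n /=; rewrite scale1r. Qed.
Fact fps_scaleDr : right_distributive fps_scale +%R.
Proof. by move=> a f g; apply: fpsP => n /=; rewrite scalerDr. Qed.
Fact fps_scaleDl f : {morph fps_scale^~ f : a b / a + b}.
Proof. by move=> a b; apply: fpsP => n /=; rewrite scalerDl. Qed.

HB.instance Definition _ := GRing.Zmodule_isLmodule.Build K (fps V)
  fps_scaleA fps_scale1 fps_scaleDr fps_scaleDl.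

Lemma coefsZ a f n : coefs (a *: f) n = a *: coefs f n. Proof. by []. Qed.
End FpsLmodule.

Section FpsRing.
Variable R : nzRingType.
Implicit Types f g : fps R.

Definition fpsC (a : R) : fps R := Fps (fun n => if n is 0 then a else 0).
Definition fpsX : fps R := Fps (fun n => (n == 1%N)%:R).
Definition fps_mul f g :=
  Fps (fun n => \sum_(i < n.+1) coefs f i * coefs g (n - i)%N).

Definition fps_trunc N f : {poly R} := \poly_(i < N) coefs f i.

Lemma coefs_mulE N f g n : (n < N)%N ->
  coefs (fps_mul f g) n = (fps_trunc N f * fps_trunc N g)`_n.
Proof.
move=> ltnN; rewrite coefM /=; apply: eq_bigr => i _.
have lein : (i <= n)%N by rewrite -ltnS.
rewrite !coef_poly (leq_ltn_trans lein ltnN).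
by rewrite (leq_ltn_trans (leq_subr _ _) ltnN).
Qed.

Fact fps_mulA : associative fps_mul.
Proof.
move=> f g h; apply: fpsP => n.
transitivity ((fps_trunc n.+1 f * (fps_trunc n.+1 g * fps_trunc n.+1 h))`_n).
  rewrite coefM; apply: eq_bigr => i _.
  rewrite coef_poly ltn_ord; congr (_ * _).
  by rewrite (@coefs_mulE n.+1) // ltnS leq_subr.
rewrite mulrA coefM; apply: eq_bigr => i _.
rewrite -coefs_mulE ?ltn_ord //; congr (_ * _).
by rewrite coef_poly ltnS leq_subr.
Qed.
Fact fps_mul1 : left_id (fpsC 1) fps_mul.
Proof.
move=> f; apply: fpsP => n /=; rewrite big_ord_recl /= mul1r subn0.
by rewrite big1 ?addr0 // => i _; rewrite mul0r.
Qed.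
Fact fps_mulr1 : right_id (fpsC 1) fps_mul.
Proof.
move=> f; apply: fpsP => n /=; rewrite big_ord_recr /= subnn mulr1.
rewrite big1 ?add0r // => i _.
by have:= ltn_ord i; rewrite -subn_gt0; case: (n - i)%N => // k _; rewrite mulr0.
Qed.
Fact fps_mulDl : left_distributive fps_mul +%R.
Proof.
move=> f g h; apply: fpsP => n /=; rewrite -big_split /=.
by apply: eq_bigr => i _; rewrite mulrDl.
Qed.
Fact fps_mulDr : right_distributive fps_mul +%R.
Proof.
move=> f g h; apply: fpsP => n /=; rewrite -big_split /=.
by apply: eq_bigr => i _; rewrite mulrDr.
Qed.
Fact fps_1neq0 : fpsC 1 != 0.
Proof.
by apply/eqP => /(congr1 (fun f => coefs f 0)) /eqP; rewrite /= oner_eq0.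
Qed.

HB.instance Definition _ := GRing.Zmodule_isNzRing.Build (fps R)
  fps_mulA fps_mul1 fps_mulr1 fps_mulDl fps_mulDr fps_1neq0.

Lemma coefsM f g n :
  coefs (f * g) n = \sum_(i < n.+1) coefs f i * coefs g (n - i)%N.
Proof. by []. Qed.
Lemma coefs1 n : coefs (1 : fps R) n = (n == 0%N)%:R.
Proof. by case: n. Qed.
Lemma coefs0M f g : coefs (f * g) 0 = coefs f 0 * coefs g 0.
Proof. by rewrite coefsM big_ord1. Qed.
Lemma coefsXn_lt f k n : coefs f 0 = 0 -> (n < k)%N -> coefs (f ^+ k) n = 0.
Proof.
move=> f0; elim: k n => // k IHk n ltnk.
rewrite exprS coefsM big1 // => -[[|i] /= lti] _; first by rewrite f0 mul0r.
rewrite IHk ?mulr0 // -ltnS (leq_trans _ ltnk) // ltnS.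
by case: n lti {ltnk} => // n lti; rewrite subSS ltnS leq_subr.
Qed.
End FpsRing.

Section FpsAlgebra.
Variables (K : comNzRingType) (A : algType K).

Fact fps_scaleAl (a : K) (f g : fps A) : a *: (f * g) = a *: f * g.
Proof.
apply: fpsP => n; rewrite coefsZ !coefsM scaler_sumr.
by apply: eq_bigr => i _; rewrite scalerAl.
Qed.
HB.instance Definition _ := GRing.Lmodule_isLalgebra.Build K (fps A) fps_scaleAl.

Fact fps_scaleAr (a : K) (f g : fps A) : a *: (f * g) = f * (a *: g).
Proof.
apply: fpsP => n; rewrite coefsZ !coefsM scaler_sumr.
by apply: eq_bigr => i _; rewrite scalerAr.
Qed.
HB.instance Definition _ := GRing.Lalgebra_isAlgebra.Build K (fps A) fps_scaleAr.
End FpsAlgebra.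

Section FpsComRing.
Variable R : comNzRingType.

Fact fps_mulC : commutative (@fps_mul R).
Proof. by move=> f g; apply: fpsP => n; rewrite !(@coefs_mulE _ n.+1) // mulrC. Qed.

HB.instance Definition _ := GRing.PzRing_hasCommutativeMul.Build (fps R) fps_mulC.
End FpsComRing.

Section FpsUnitRing.
Variable R : comUnitRingType.
Implicit Types f g : fps R.

Definition fps_unit : pred (fps R) := [pred f | coefs f 0 \is a GRing.unit].

(* With u := 1 - f / f(0), the inverse of f is f(0)^-1 * (1 + u + u^2 + ...);
   the powers of u beyond the n-th do not contribute to the coefficient n. *)
Definition fps_inv f : fps R :=
  if fps_unit f then
    let c := fpsC (coefs f 0)^-1 in
    c * Fps (fun n => coefs (\sum_(k < n.+1) (1 - c * f) ^+ k) n)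
  else f.

Fact fps_mulVr : {in fps_unit, left_inverse 1 fps_inv *%R}.
Proof.
move=> f unit_f; rewrite /fps_inv [fps_unit f]unit_f /=.
set c := fpsC _; set S := Fps _; set u := 1 - c * f.
have u0 : coefs u 0 = 0.
  by rewrite coefsB coefs0M coefs1 /= mulVr ?subrr.
rewrite mulrAC; have -> : c * f = 1 - u by rewrite opprB addrC subrK.
apply: fpsP => n.
transitivity (coefs ((1 - u) * \sum_(k < n.+1) u ^+ k) n).
  rewrite !coefsM; apply: eq_bigr => i _; congr (_ * _).
  rewrite /= !coefs_sum.
  have le : ((n - i).+1 <= n.+1)%N by rewrite ltnS leq_subr.
  rewrite -(big_mkord xpredT (fun k => coefs (u ^+ k) (n - i)%N)).
  rewrite -(big_mkord xpredT (fun k => coefs (u ^+ k) (n - i)%N)).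
  rewrite [RHS](big_cat_nat (n := (n - i).+1)) //=.
  rewrite [X in _ + X]big_nat_cond [X in _ + X]big1 ?addr0 //.
  by move=> k /andP [/andP [lek _] _]; apply: coefsXn_lt.
rewrite -[1 - u]opprB mulNr -subrX1.
by rewrite opprB coefsB coefsXn_lt ?subr0.
Qed.
Fact fps_unitP f g : g * f = 1 -> fps_unit f.
Proof.
move=> /(congr1 (fun h => coefs h 0)); rewrite coefs0M coefs1 /= => gf1.
by apply/unitrP; exists (coefs g 0); rewrite gf1 mulrC gf1.
Qed.
Fact fps_invr_out : {in [predC fps_unit], fps_inv =1 id}.
Proof. by move=> f /negbTE nu_f; rewrite /fps_inv -[fps_unit f]/(f \in fps_unit) nu_f. Qed.

HB.instance Definition _ := GRing.ComNzRing_hasMulInverse.Build (fps R)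
  fps_mulVr fps_unitP fps_invr_out.
End FpsUnitRing.

HB.instance Definition _ (K : comNzRingType) (A : comUnitAlgType K) :=
  GRing.Algebra.on (fps A).

(* The same series, multiplied coefficientwise (Hadamard product). *)
Record hps (R : Type) := Hps { fps_of : fps R }.

Lemma hpsP (R : Type) (f g : hps R) :
  (forall n, coefs (fps_of f) n = coefs (fps_of g) n) -> f = g.
Proof. by case: f g => [f] [g] /= /fpsP ->. Qed.

HB.instance Definition _ (R : Type) := gen_eqMixin (hps R).
HB.instance Definition _ (R : Type) := gen_choiceMixin (hps R).

Section HpsZmodule.
Variable R : zmodType.
Implicit Types f g : hps R.

Definition hps_zero : hps R := Hps 0.
Definition hps_opp f := Hps (- fps_of f).
Definition hps_add f g := Hps (fps_of f + fps_of g).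

Fact hps_addA : associative hps_add.
Proof. by move=> f g h; congr Hps; rewrite addrA. Qed.
Fact hps_addC : commutative hps_add.
Proof. by move=> f g; congr Hps; rewrite addrC. Qed.
Fact hps_add0 : left_id hps_zero hps_add.
Proof. by case=> f; congr Hps; rewrite add0r. Qed.
Fact hps_addN : left_inverse hps_zero hps_opp hps_add.
Proof. by move=> f; congr Hps; rewrite addNr. Qed.

HB.instance Definition _ :=
  GRing.isZmodule.Build (hps R) hps_addA hps_addC hps_add0 hps_addN.
End HpsZmodule.

Section HpsLmodule.
Variables (K : pzRingType) (V : lmodType K).
Implicit Types f g : hps V.

Definition hps_scale (a : K) f := Hps (a *: fps_of f).

Fact hps_scaleA a b f : hps_scale a (hps_scale b f) = hps_scale (a * b) f.
Proof. by congr Hps; rewrite scalerA. Qed.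
Fact hps_scale1 : left_id 1 hps_scale.
Proof. by case=> f; congr Hps; rewrite scale1r. Qed.
Fact hps_scaleDr : right_distributive hps_scale +%R.
Proof. by move=> a f g; congr Hps; rewrite scalerDr. Qed.
Fact hps_scaleDl f : {morph hps_scale^~ f : a b / a + b}.
Proof. by move=> a b; congr Hps; rewrite scalerDl. Qed.

HB.instance Definition _ := GRing.Zmodule_isLmodule.Build K (hps V)
  hps_scaleA hps_scale1 hps_scaleDr hps_scaleDl.
End HpsLmodule.

Section HpsRing.
Variable R : nzRingType.
Implicit Types f g h : hps R.

Definition hps_one : hps R := Hps (Fps (fun=> 1)).
Definition hps_mul f g : hps R :=
  Hps (Fps (fun n => coefs (fps_of f) n * coefs (fps_of g) n)).

Fact hps_mulA : associative hps_mul.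
Proof. by move=> f g h; apply: hpsP => n /=; rewrite mulrA. Qed.
Fact hps_mul1 : left_id hps_one hps_mul.
Proof. by move=> f; apply: hpsP => n /=; rewrite mul1r. Qed.
Fact hps_mulr1 : right_id hps_one hps_mul.
Proof. by move=> f; apply: hpsP => n /=; rewrite mulr1. Qed.
Fact hps_mulDl : left_distributive hps_mul +%R.
Proof. by move=> f g h; apply: hpsP => n /=; rewrite mulrDl. Qed.
Fact hps_mulDr : right_distributive hps_mul +%R.
Proof. by move=> f g h; apply: hpsP => n /=; rewrite mulrDr. Qed.
Fact hps_1neq0 : hps_one != 0.
Proof.
apply/eqP => /(congr1 (fun f => coefs (fps_of f) 0)) /eqP.
by rewrite /= oner_eq0.
Qed.

HB.instance Definition _ := GRing.Zmodule_isNzRing.Build (hps R)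
  hps_mulA hps_mul1 hps_mulr1 hps_mulDl hps_mulDr hps_1neq0.
End HpsRing.

Section HpsAlgebra.
Variables (K : comNzRingType) (A : algType K).

Fact hps_scaleAl (a : K) (f g : hps A) : a *: (f * g) = a *: f * g.
Proof. by apply: hpsP => n /=; rewrite scalerAl. Qed.
HB.instance Definition _ := GRing.Lmodule_isLalgebra.Build K (hps A) hps_scaleAl.

Fact hps_scaleAr (a : K) (f g : hps A) : a *: (f * g) = f * (a *: g).
Proof. by apply: hpsP => n /=; rewrite scalerAr. Qed.
HB.instance Definition _ := GRing.Lalgebra_isAlgebra.Build K (hps A) hps_scaleAr.
End HpsAlgebra.

Fact hps_mulC (R : comNzRingType) : commutative (@hps_mul R).
Proof. by move=> f g; apply: hpsP => n /=; rewrite mulrC. Qed.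
HB.instance Definition _ (R : comNzRingType) :=
  GRing.PzRing_hasCommutativeMul.Build (hps R) (@hps_mulC R).

HB.instance Definition _ (K : comNzRingType) (A : comAlgType K) :=
  GRing.Algebra.on (hps A).

Lemma hps_oneE (R : comUnitRingType) : (1 : hps R) = Hps (1 - fpsX R)^-1.
Proof.
congr Hps; have u : (1 - fpsX R) \is a GRing.unit.
  change (coefs (1 - fpsX R) 0 \is a GRing.unit).
  by rewrite coefsB /= subr0 unitr1.
apply: (mulrI u); rewrite divrr //; apply: fpsP => n.
rewrite mulrBl mul1r coefsB coefsM /=; case: n => [|n].
  by rewrite big_ord1 mul0r subr0.
rewrite 2!big_ord_recl /= mul0r mul1r add0r big1 ?addr0 ?subrr //.
Qed.


(* The permutation groups 'S_n act on {0, ..., n-1}; [word p] is the one-line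
   notation of p as a word on {1, ..., n}. *)
Definition word n (p : 'S_n) : seq nat := [seq (p i).+1 | i <- enum 'I_n].

Lemma size_word n (p : 'S_n) : size (word p) = n.
Proof. by rewrite size_map size_enum_ord. Qed.

Lemma nth_word n (p : 'S_n) (i : 'I_n) : nth 0%N (word p) i = (p i).+1.
Proof. by rewrite (nth_map i) ?size_enum_ord ?nth_ord_enum. Qed.

(* The disjoint union of all symmetric groups. *)
Notation Perm := {n : nat & 'S_n}.
Notation "[ 'Perm' p ]" := (Tagged (fun n => 'S_n) p)
  (at level 0, format "[ 'Perm'  p ]").

Section Standardization.
Implicit Types (w : seq nat) (n i j : nat).

(* Letters are compared by value, equal letters by position. *)
Definition letter_lt w i j :=
  (nth 0 w i < nth 0 w j)%N || (nth 0 w i == nth 0 w j) && (i < j)%N.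

Lemma letter_lt_irr w i : letter_lt w i i = false.
Proof. by rewrite /letter_lt !ltnn andbF. Qed.

Lemma letter_lt_trans w : transitive (letter_lt w).
Proof.
rewrite /letter_lt => j i k /orP [ltij|/andP [/eqP -> ltij]].
  by case/orP => [/(ltn_trans ltij) ->|/andP [/eqP <- _]] //; rewrite ltij.
case/orP => [-> //|/andP [/eqP -> /(ltn_trans ltij) ->]].
by rewrite eqxx orbT.
Qed.

Lemma letter_lt_total w i j : i != j -> letter_lt w i j || letter_lt w j i.
Proof.
rewrite /letter_lt => neq; case: (ltngtP (nth 0%N w i)) => //= _.
by rewrite -neq_ltn.
Qed.

Lemma letter_lt_asym w i j : letter_lt w i j -> letter_lt w j i = false.
Proof.
by move=> ltij; apply/negP => /(letter_lt_trans ltij); rewrite letter_lt_irr.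
Qed.

Definition std_rank n w (i : 'I_n) : nat := #|[set j : 'I_n | letter_lt w j i]|.

Fact std_rank_lt n w (i : 'I_n) : (std_rank w i < n)%N.
Proof.
rewrite -[X in (_ < X)%N](card_ord n) -cardsT; apply: proper_card.
by rewrite properT; apply/eqP => /setP /(_ i); rewrite !inE letter_lt_irr.
Qed.

Lemma std_rank_mono n w (i j : 'I_n) :
  (std_rank w i < std_rank w j)%N = letter_lt w i j.
Proof.
suff mono (k l : 'I_n) : letter_lt w k l -> (std_rank w k < std_rank w l)%N.
  apply/idP/idP => [|/mono //]; apply: contraTT => nlt.
  have [-> | neq] := eqVneq i j; first by rewrite ltnn.
  have := letter_lt_total w neq; rewrite (negbTE nlt) => /mono.
  by rewrite -leqNgt; apply: ltnW.
move=> ltkl; apply: proper_card; apply/properP; split.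
  by apply/subsetP => a; rewrite !inE => /letter_lt_trans; apply.
by exists k; rewrite inE // letter_lt_irr.
Qed.

Fact std_inj n w : injective (fun i : 'I_n => Ordinal (std_rank_lt w i)).
Proof.
move=> i j /(congr1 val) /= eq_rk; apply/eqP; apply: contraT => neq.
by have := letter_lt_total w neq; rewrite -!std_rank_mono eq_rk ltnn.
Qed.

Definition std_perm n w : 'S_n := perm (@std_inj n w).
Definition std w : Perm := [Perm std_perm (size w) w].

Lemma std_size n w : size w = n -> std w = [Perm std_perm n w].
Proof. by move=> <-. Qed.

Lemma std_permE n w (i : 'I_n) : std_perm n w i = std_rank w i :> nat.
Proof. by rewrite permE. Qed.

Lemma eq_std_perm n w w' :
  (forall i j : 'I_n, letter_lt w i j = letter_lt w' i j) ->
  std_perm n w = std_perm n w'.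
Proof.
move=> eq_lt; apply/permP => i; apply: val_inj; rewrite /= !std_permE.
by apply: eq_card => j; rewrite !inE eq_lt.
Qed.

Lemma letter_lt_word n (p : 'S_n) (i j : 'I_n) :
  letter_lt (word p) i j = (p i < p j)%N.
Proof.
rewrite /letter_lt !nth_word ltnS eqSS; have [->|neq] := eqVneq i j.
  by rewrite !ltnn andbF.
by rewrite (inj_eq val_inj) (inj_eq perm_inj) (negbTE neq) orbF.
Qed.

Lemma std_perm_word n (p : 'S_n) : std_perm n (word p) = p.
Proof.
apply/permP => i; apply: val_inj; rewrite /= std_permE /std_rank.
rewrite (eq_card (B := p @^-1: [set j : 'I_n | (j < p i)%N])); last first.
  by move=> j; rewrite !inE letter_lt_word.
rewrite on_card_preimset; last first.
  by exists (p^-1)%g => j _; rewrite ?permK ?permKV.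
by rewrite -sum1dep_card (big_ord_narrow (ltnW (ltn_ord (p i)))) sum1_card card_ord.
Qed.

Lemma std_word n (p : 'S_n) : std (word p) = [Perm p].
Proof. by rewrite (std_size (size_word p)) std_perm_word. Qed.

Lemma letter_lt_std n w (i j : 'I_n) :
  letter_lt (word (std_perm n w)) i j = letter_lt w i j.
Proof. by rewrite letter_lt_word !std_permE std_rank_mono. Qed.

Lemma std_take_word m n w : size w = (m + n)%N ->
  std (take m (word (std_perm (m + n) w))) = std (take m w).
Proof.
move=> sz_w; rewrite !(@std_size m) ?size_takel ?size_word ?sz_w ?leq_addr //.
congr Tagged; apply: eq_std_perm => i j.
have := letter_lt_std w (lshift n i) (lshift n j).
by rewrite /letter_lt !nth_take.
Qed.

Lemma std_drop_word m n w : size w = (m + n)%N ->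
  std (drop m (word (std_perm (m + n) w))) = std (drop m w).
Proof.
move=> sz_w; rewrite !(@std_size n) ?size_drop ?size_word ?sz_w ?addKn //.
congr Tagged; apply: eq_std_perm => i j.
have := letter_lt_std w (rshift m i) (rshift m j).
by rewrite /letter_lt !nth_drop /= ltn_add2l.
Qed.

Lemma std_nil (p : Perm) : tag p = 0%N -> p = [Perm (1 : 'S_0)%g].
Proof.
by case: p => n p /= n0; subst n; congr Tagged; apply/permP => -[].
Qed.
End Standardization.

(* Noncommutative formal power series over Q, as functions on words; the letter
   k of a word stands for the variable X_k. (The letter 0 is allowed as well,
   which only adds one more variable to a countable ordered alphabet.) *)
Record ncseries := NCSeries { wcoef : seq nat -> rat }.

Lemma ncseriesP (f g : ncseries) : (forall w, wcoef f w = wcoef g w) -> f = g.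
Proof. by case: f g => [f] [g] /= /funext ->. Qed.

HB.instance Definition _ := gen_eqMixin ncseries.
HB.instance Definition _ := gen_choiceMixin ncseries.

Section NCSeries.
Implicit Types f g h : ncseries.

Definition nc_zero := NCSeries (fun=> 0).
Definition nc_opp f := NCSeries (fun w => - wcoef f w).
Definition nc_add f g := NCSeries (fun w => wcoef f w + wcoef g w).
Definition nc_scale (a : rat) f := NCSeries (fun w => a * wcoef f w).
Definition nc_one := NCSeries (fun w => (w == [::])%:R).
Definition nc_mul f g := NCSeries (fun w =>
  \sum_(i < (size w).+1) wcoef f (take i w) * wcoef g (drop i w)).

Fact nc_addA : associative nc_add.
Proof. by move=> f g h; apply: ncseriesP => w /=; rewrite addrA. Qed.
Fact nc_addC : commutative nc_add.
Proof. by move=> f g; apply: ncseriesP => w /=; rewrite addrC. Qed.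
Fact nc_add0 : left_id nc_zero nc_add.
Proof. by move=> f; apply: ncseriesP => w /=; rewrite add0r. Qed.
Fact nc_addN : left_inverse nc_zero nc_opp nc_add.
Proof. by move=> f; apply: ncseriesP => w /=; rewrite addNr. Qed.

HB.instance Definition _ :=
  GRing.isZmodule.Build ncseries nc_addA nc_addC nc_add0 nc_addN.

Fact nc_scaleA a b f : nc_scale a (nc_scale b f) = nc_scale (a * b) f.
Proof. by apply: ncseriesP => w /=; rewrite mulrA. Qed.
Fact nc_scale1 : left_id 1 nc_scale.
Proof. by move=> f; apply: ncseriesP => w /=; rewrite mul1r. Qed.
Fact nc_scaleDr : right_distributive nc_scale +%R.
Proof. by move=> a f g; apply: ncseriesP => w /=; rewrite mulrDr. Qed.
Fact nc_scaleDl f : {morph nc_scale^~ f : a b / a + b}.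
Proof. by move=> a b; apply: ncseriesP => w /=; rewrite mulrDl. Qed.

HB.instance Definition _ := GRing.Zmodule_isLmodule.Build rat ncseries
  nc_scaleA nc_scale1 nc_scaleDr nc_scaleDl.

Lemma nc_reindex s (i : 'I_s.+1) (F : nat -> rat) :
  \sum_(k < s.+1 | (i <= k)%N) F k = \sum_(j < (s - i).+1) F (j + i)%N.
Proof.
rewrite -(big_geq_mkord i s.+1 xpredT F) -{1}(add0n i) big_addn.
by rewrite big_mkord subSn // -ltnS.
Qed.

Fact nc_mulA : associative nc_mul.
Proof.
move=> f g h; apply: ncseriesP => w /=; set s := size w.
pose F i k := wcoef f (take i w) * wcoef g (drop i (take k w)) * wcoef h (drop k w).
transitivity (\sum_(i < s.+1) \sum_(k < s.+1 | (i <= k)%N) F i k).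
  apply: eq_bigr => i _; rewrite big_distrr /= size_drop -/s nc_reindex.
  by apply: eq_bigr => j _; rewrite /F mulrA drop_drop take_drop.
rewrite (exchange_big_dep xpredT) //=; apply: eq_bigr => k _.
have le_ks : (k <= s)%N by rewrite -ltnS.
rewrite size_takel // big_distrl /=.
rewrite (eq_bigl (fun i : 'I_s.+1 => (i < k.+1)%N)) //.
rewrite (big_ord_narrow (ltn_ord k)) /=.
by apply: eq_bigr => i _; rewrite /F take_takel // -ltnS.
Qed.
Fact nc_mul1 : left_id nc_one nc_mul.
Proof.
move=> f; apply: ncseriesP => w /=; rewrite big_ord_recl /= take0 drop0 mul1r.
rewrite big1 ?addr0 // => i _.
by case: w i => [[]//|a w] i; rewrite mul0r.
Qed.
Fact nc_mulr1 : right_id nc_one nc_mul.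
Proof.
move=> f; apply: ncseriesP => w /=.
rewrite big_ord_recr /= take_size drop_size mulr1 big1 ?add0r // => i _.
rewrite -size_eq0 size_drop subn_eq0 leqNgt ltn_ord mulr0 //.
Qed.
Fact nc_mulDl : left_distributive nc_mul +%R.
Proof.
move=> f g h; apply: ncseriesP => w /=; rewrite -big_split /=.
by apply: eq_bigr => i _; rewrite mulrDl.
Qed.
Fact nc_mulDr : right_distributive nc_mul +%R.
Proof.
move=> f g h; apply: ncseriesP => w /=; rewrite -big_split /=.
by apply: eq_bigr => i _; rewrite mulrDr.
Qed.
Fact nc_1neq0 : nc_one != 0.
Proof. by apply/eqP => /(congr1 (fun f => wcoef f [::])). Qed.

HB.instance Definition _ := GRing.Zmodule_isNzRing.Build ncseries
  nc_mulA nc_mul1 nc_mulr1 nc_mulDl nc_mulDr nc_1neq0.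

Fact nc_scaleAl (a : rat) f g : a *: (f * g) = a *: f * g.
Proof.
apply: ncseriesP => w /=; rewrite big_distrr /=.
by apply: eq_bigr => i _; rewrite mulrA.
Qed.
HB.instance Definition _ := GRing.Lmodule_isLalgebra.Build rat ncseries nc_scaleAl.

Fact nc_scaleAr (a : rat) f g : a *: (f * g) = f * (a *: g).
Proof.
apply: ncseriesP => w /=; rewrite big_distrr /=.
by apply: eq_bigr => i _; rewrite mulrCA.
Qed.
HB.instance Definition _ := GRing.Lalgebra_isAlgebra.Build rat ncseries nc_scaleAr.
End NCSeries.

(* The sum of all words with standardization p. *)
Definition ncG (p : Perm) : ncseries := NCSeries (fun w => (std w == p)%:R).

(* FQSym is the space with basis (G p), equipped with the product [fqsym_mul];
   [realize] below identifies it with the subalgebra of [ncseries] spanned by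
   the series [ncG p]. *)
Definition fqsym := {malg rat[Perm]}.
HB.instance Definition _ := GRing.Lmodule.copy fqsym {malg rat[Perm]}.

Definition G (p : Perm) : fqsym := << p >>.

Section LinearExtension.
Variables (V : lmodType rat) (F : Perm -> V).

Definition linext (f : fqsym) : V := \sum_(p <- msupp f) f@_p *: F p.

Lemma linextEw (f : fqsym) (d : {fset Perm}) : (msupp f `<=` d)%fset ->
  linext f = \sum_(p <- d) f@_p *: F p.
Proof.
move=> le_fd; rewrite /linext; apply: big_fset_incl => // p _ pNf.
by rewrite mcoeff_outdom ?scale0r.
Qed.

Fact linext_is_linear : linear linext.
Proof.
move=> a f g; pose d := (msupp (a *: f + g) `|` msupp f `|` msupp g)%fset.
rewrite !(@linextEw _ d).
- rewrite scaler_sumr -big_split /=; apply: eq_bigr => p _.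
  by rewrite mcoeffD mcoeffZ scalerDl scalerA.
- exact: fsubsetUr.
- by rewrite /d -fsetUA fsetUCA fsubsetUl.
- by rewrite /d -fsetUA fsubsetUl.
Qed.
HB.instance Definition _ :=
  GRing.isLinear.Build rat fqsym V *:%R linext linext_is_linear.

Lemma linextG p : linext (G p) = F p.
Proof.
by rewrite /linext /G msuppU oner_eq0 big_seq_fset1 mcoeffUU scale1r.
Qed.
End LinearExtension.

Lemma fqsymE (f : fqsym) : f = linext G f.
Proof.
rewrite {1}[f]monalgE; apply: eq_bigr => p _.
by apply/malgP => q; rewrite mcoeffZ !mcoeffU mulr_natr.
Qed.

(* The set C(p, q). *)
Definition std_concat (p q : Perm) : {set 'S_(tag p + tag q)} :=
  [set r | (std (take (tag p) (word r)) == p)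
           && (std (drop (tag p) (word r)) == q)].

HB.lock Definition fqsym_mul (f g : fqsym) : fqsym :=
  linext (fun p => linext (fun q => \sum_(r in std_concat p q) G [Perm r]) g) f.

Definition fqsym_one : fqsym := G [Perm (1 : 'S_0)%g].

Definition realize (f : fqsym) : ncseries := NCSeries (fun w => f@_(std w)).

Fact realize_is_linear : linear realize.
Proof. by move=> a f g; apply: ncseriesP => w /=; rewrite mcoeffD mcoeffZ. Qed.
HB.instance Definition _ :=
  GRing.isLinear.Build rat fqsym ncseries *:%R realize realize_is_linear.

Lemma realizeD : {morph realize : f g / f + g}.
Proof. exact: linearD. Qed.

Lemma realizeZ a : {morph realize : f / a *: f}.
Proof. exact: linearZ. Qed.

Lemma realizeG p : realize (G p) = ncG p.
Proof. by apply: ncseriesP => w /=; rewrite mcoeffU eq_sym. Qed.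

Lemma realize_inj : injective realize.
Proof.
move=> f g eq_fg; apply/malgP => -[n p].
by have := congr1 (fun f => wcoef f (word p)) eq_fg; rewrite /= std_word.
Qed.

Lemma ncGM p q : ncG p * ncG q = \sum_(r in std_concat p q) ncG [Perm r].
Proof.
apply: ncseriesP => w.
have -> : wcoef (\sum_(r in std_concat p q) ncG [Perm r]) w =
          \sum_(r in std_concat p q) (std w == [Perm r])%:R.
  exact: (big_morph (fun f => wcoef f w)).
rewrite /=.
have [sz_w|sz_w] := eqVneq (size w) (tag p + tag q)%N; last first.
  rewrite big1 => [|i _].
    rewrite big1 // => r _; case: eqP => // /(congr1 tag) /= sz.
    by rewrite -sz eqxx in sz_w.
  rewrite -natrM mulnb; case: andP => // -[/eqP Ep /eqP Eq]; move: sz_w.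
  have /= <- := congr1 tag Eq; have /= <- := congr1 tag Ep => sz_w.
  by rewrite -size_cat cat_take_drop eqxx in sz_w.
have lt_p : (tag p < (size w).+1)%N by rewrite ltnS sz_w leq_addr.
rewrite (bigD1 (Ordinal lt_p)) //= [X in _ + X]big1 ?addr0; last first.
  move=> i neq; case: eqP => [/(congr1 tag) /= E|]; rewrite ?mul0r //.
  case/eqP: neq; apply: val_inj => /=; rewrite -E size_takel //.
  by rewrite -ltnS.
rewrite (std_size sz_w) -natrM mulnb.
rewrite -(std_take_word sz_w) -(std_drop_word sz_w).
set r0 := std_perm _ _.
have -> : (std (take (tag p) (word r0)) == p) && (std (drop (tag p) (word r0)) == q)
          = (r0 \in std_concat p q) by rewrite inE.
have [r0in|r0nin] := boolP (r0 \in std_concat p q).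
  rewrite (bigD1 r0) //= eqxx big1 ?addr0 // => r /andP [_ neq].
  by rewrite eq_Tagged /= eq_sym (negbTE neq).
rewrite big1 // => r rin; rewrite eq_Tagged /=.
by case: eqP r0nin => // ->; rewrite rin.
Qed.

Lemma realize_linext (F : Perm -> fqsym) f :
  realize (linext F f) = \sum_(p <- msupp f) f@_p *: realize (F p).
Proof. by rewrite linear_sum; apply: eq_bigr => p _; rewrite linearZ. Qed.

Lemma realizeE f : realize f = \sum_(p <- msupp f) f@_p *: ncG p.
Proof.
rewrite {1}[f]fqsymE realize_linext.
by apply: eq_bigr => p _; rewrite realizeG.
Qed.

Lemma realizeM f g : realize (fqsym_mul f g) = realize f * realize g.
Proof.
rewrite unlock realize_linext [realize f]realizeE mulr_suml; apply: eq_bigr => p _.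
rewrite realize_linext -scalerAl [realize g]realizeE mulr_sumr.
congr (_ *: _); apply: eq_bigr => q _.
rewrite -scalerAr ncGM linear_sum /=; congr (_ *: _).
by apply: eq_bigr => r _; rewrite realizeG.
Qed.

Lemma realize1 : realize fqsym_one = 1.
Proof.
rewrite /fqsym_one realizeG; apply: ncseriesP => w /=; congr (nat_of_bool _)%:R.
rewrite -size_eq0; apply/eqP/eqP => [/(congr1 tag) //|w0].
exact: std_nil.
Qed.

Fact fqsym_mulA : associative fqsym_mul.
Proof. by move=> f g h; apply: realize_inj; rewrite !realizeM mulrA. Qed.
Fact fqsym_mul1 : left_id fqsym_one fqsym_mul.
Proof. by move=> f; apply: realize_inj; rewrite realizeM realize1 mul1r. Qed.
Fact fqsym_mulr1 : right_id fqsym_one fqsym_mul.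
Proof. by move=> f; apply: realize_inj; rewrite realizeM realize1 mulr1. Qed.
Fact fqsym_mulDl : left_distributive fqsym_mul +%R.
Proof. by move=> f g h; rewrite unlock linearD. Qed.
Fact fqsym_mulDr : right_distributive fqsym_mul +%R.
Proof.
move=> f g h; apply: realize_inj; rewrite (realizeM f) !realizeD !(realizeM f).
by rewrite mulrDr.
Qed.
Fact fqsym_1neq0 : fqsym_one != 0.
Proof.
by apply/eqP => /(congr1 realize); rewrite realize1 linear0 => /eqP; rewrite oner_eq0.
Qed.

HB.instance Definition _ := GRing.Zmodule_isNzRing.Build fqsym
  fqsym_mulA fqsym_mul1 fqsym_mulr1 fqsym_mulDl fqsym_mulDr fqsym_1neq0.

Fact fqsym_scaleAl (a : rat) (f g : fqsym) : a *: (f * g) = (a *: f : fqsym) * g.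
Proof. by rewrite /GRing.mul /= unlock linearZ. Qed.
HB.instance Definition _ := GRing.Lmodule_isLalgebra.Build rat fqsym fqsym_scaleAl.

Fact fqsym_scaleAr (a : rat) (f g : fqsym) : a *: (f * g) = f * (a *: g : fqsym).
Proof.
apply: realize_inj; rewrite realizeZ.
by rewrite /GRing.mul /= (realizeM f) (realizeM f) realizeZ scalerAr.
Qed.
HB.instance Definition _ := GRing.Lalgebra_isAlgebra.Build rat fqsym fqsym_scaleAr.

Fact realize_is_monoid_morphism : monoid_morphism realize.
Proof. by split; [exact: realize1 | exact: realizeM]. Qed.
HB.instance Definition _ :=
  GRing.isMonoidMorphism.Build fqsym ncseries realize realize_is_monoid_morphism.

Lemma GM p q : G p * G q = \sum_(r in std_concat p q) G [Perm r].
Proof. by rewrite /GRing.mul /= unlock !linextG. Qed.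

(* Permutation statistics; positions in one-line notation are 1-based. *)
Section Statistics.
Variables (n : nat) (p : 'S_n).

Definition letter (i : nat) : nat := nth 0%N (word p) i.-1.

Definition is_des (i : nat) : bool := (letter i.+1 < letter i)%N.
Definition is_peak (i : nat) : bool :=
  (letter i.-1 < letter i)%N && (letter i.+1 < letter i)%N.

Definition des : nat := \sum_(1 <= i < n | is_des i) 1.
Definition comaj : nat := \sum_(1 <= i < n | is_des i) (n - i).
Definition pk : nat := \sum_(2 <= i < n | is_peak i) 1.
Definition lpk : nat := pk + ((1 < n)%N && is_des 1).
End Statistics.

Lemma leq_sparse_sum (P : pred nat) m k : (forall i, P i -> ~~ P i.+1) ->
  (2 * (\sum_(m <= i < m + k | P i) 1) <= k + ((0 < k) && P (m + k).-1))%N.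
Proof.
move=> sparse; elim: k => [|k IHk]; first by rewrite addn0 big_geq.
have -> : (\sum_(m <= i < m + k.+1 | P i) 1 =
           \sum_(m <= i < m + k | P i) 1 + P (m + k))%N.
  rewrite addnS big_mkcond big_nat_recr ?leq_addr //= [in RHS]big_mkcond /=.
  by case: (P _).
move: IHk; set S := (\sum_(_ <= i < _ | _) 1)%N; rewrite addnS /= mulnDr.
case: (boolP (P (m + k)%N)) => Pk IHk; last first.
  rewrite muln0 !addn0; apply: leq_trans IHk _.
  by rewrite -[k.+1]addn1 leq_add2l leq_b1.
rewrite -[k.+1]addn1 -addnA leq_add2r; apply: leq_trans IHk _.
case: k Pk {S} => // k; rewrite addnS /= => Pk.
by rewrite (contraTF (@sparse (m + k)%N)) ?addn0 //= negbK.
Qed.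

Lemma leq_sparse_sumS (P : pred nat) m k : (forall i, P i -> ~~ P i.+1) ->
  (2 * (\sum_(m <= i < m + k | P i) 1) <= k.+1)%N.
Proof.
move=> sparse; apply: leq_trans (leq_sparse_sum m k sparse) _.
by rewrite -[k.+1]addn1 leq_add2l leq_b1.
Qed.

Lemma is_peak_sparse n (p : 'S_n) i : is_peak p i -> ~~ is_peak p i.+1.
Proof.
case/andP => _ lti; rewrite negb_and; apply/orP; left.
by rewrite -leqNgt; apply: ltnW.
Qed.

Lemma leq_pk n (p : 'S_n) : (0 < n)%N -> (2 * pk p + 1 <= n)%N.
Proof.
case: n p => [//|[|n]] p _; first by rewrite /pk big_geq.
have := leq_sparse_sumS 2 n (@is_peak_sparse _ p).
by rewrite /pk !add2n addn1 ltnS.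
Qed.

Lemma leq_lpk n (p : 'S_n) : (2 * lpk p <= n)%N.
Proof.
rewrite /lpk /pk.
case: n p => [|[|n]] p; [by rewrite big_geq | by rewrite big_geq |].
pose P i := if i == 1%N then is_des p 1 else is_peak p i.
have sparse i : P i -> ~~ P i.+1.
  rewrite /P; case: i => [|[|i]] /=.
  - by rewrite /is_peak ltnn.
  - by rewrite /is_des /is_peak /= => /ltnW; rewrite leqNgt negb_and => ->.
  - exact: is_peak_sparse.
apply: leq_trans (leq_sparse_sumS 1 n.+1 sparse); rewrite leq_mul2l /=.
rewrite add1n [X in (_ <= X)%N]big_ltn_cond //.
rewrite [X in (X + _ <= _)%N](_ : _ = \sum_(2 <= i < n.+2 | P i) 1)%N; last first.
  rewrite big_nat_cond [RHS]big_nat_cond; apply: eq_bigl => i.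
  by case: (boolP (2 <= i < n.+2)%N) => //= /andP [lt1i _]; rewrite /P gtn_eqF.
rewrite (_ : P 1%N = is_des p 1) // addnC.
by case: (is_des p 1).
Qed.

Definition ides n (p : 'S_n) := des p^-1%g.
Definition icomaj n (p : 'S_n) := comaj p^-1%g.
Definition ipk n (p : 'S_n) := pk p^-1%g.
Definition ilpk n (p : 'S_n) := lpk p^-1%g.

(* Q[[x]] and Q[[q, x]]. *)
Definition Qx := fps rat^o.
HB.instance Definition _ := GRing.ComUnitAlgebra.copy Qx (fps rat^o).
Definition Qqx := fps Qx.
HB.instance Definition _ := GRing.ComUnitAlgebra.copy Qqx (fps Qx).

Definition Psi_ides_icomaj : fqsym -> hps Qqx :=
  let t : fps Qqx := fpsX Qqx in
  let q : fps Qqx := fpsC (fpsX Qx : Qqx) in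
  let x : fps Qqx := fpsC (fpsC (fpsX rat^o : Qx) : Qqx) in
  linext (fun p : Perm => let n := tag p in let pi := tagged p in
    Hps (if n == 0%N then (1 - t)^-1
         else t ^+ (ides pi).+1 * q ^+ icomaj pi
              / (\prod_(0 <= i < n.+1) (1 - t * q ^+ i)) * x ^+ n)).

(* The exponents n - 2 * ipk - 1 (for n >= 1) and n - 2 * ilpk are never
   truncated, cf. [leq_pk] and [leq_lpk]. *)
Definition Psi_ipk : fqsym -> hps Qx :=
  let t : fps Qx := fpsX Qx in
  let x : fps Qx := fpsC (fpsX rat^o : Qx) in
  linext (fun p : Perm => let n := tag p in let pi := tagged p in
    Hps (if n == 0%N then (1 - t)^-1
         else 2 ^+ (2 * ipk pi + 1) * t ^+ (ipk pi + 1)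
              * (1 + t) ^+ (n - 2 * ipk pi - 1)
              / (1 - t) ^+ n.+1 * x ^+ n)).

Definition Psi_ilpk : fqsym -> hps Qx :=
  let t : fps Qx := fpsX Qx in
  let x : fps Qx := fpsC (fpsX rat^o : Qx) in
  linext (fun p : Perm => let n := tag p in let pi := tagged p in
    Hps (2 ^+ (2 * ilpk pi) * t ^+ ilpk pi * (1 + t) ^+ (n - 2 * ilpk pi)
         / (1 - t) ^+ n.+1 * x ^+ n)).

(* Unital homomorphisms of Q-algebras. *)
Definition alg_hom (A B : algType rat) (f : A -> B) : Prop :=
  linear f /\ monoid_morphism f.

(* Main.v *)
From mathcomp Require Import all_boot all_order all_algebra all_fingroup.
From mathcomp Require Import finmap monalg zify ring.
Require Import Defs.

(* Let each letter of a finite ordered alphabet be positive or negative, and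
   standardize words so that equal positive letters increase and equal negative
   letters decrease from left to right. Sending G_p to the weighted sum of the
   words that standardize to p defines an algebra homomorphism, because
   standardization commutes with restriction to prefixes and suffixes. For each
   of the three maps Psi, the coefficient of t^k in Psi(G_p) is such a sum: for
   (ides, icomaj) over k positive letters with weights x, qx, ..., q^(k-1) x; for
   ilpk over 0 < -1 < 1 < ... < -k < k and for ipk over -1 < 1 < ... < -k < k,
   with all weights x. As the product of the coefficients of t^k is the Hadamard
   product, this proves the theorem.

   To compute the coefficients, reorder a word by p^-1: it becomes a weakly
   increasing chain of letters in which a positive letter may be repeated only
   at an ascent of p^-1, a negative one only at a descent. Adding the last letter
   of the chain acts on the generating function in t by a simple factor that
   depends on the last two positions: for (ides, icomaj) it is t^d / (1 - t)
   (d = 1 at a descent, d = 0 otherwise), followed by the substitution t := qt;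
   for the peak statistics it is 2t / (1 - t) at a peak, 2 / (1 - t) at a valley
   and (1 + t) / (1 - t) elsewhere. *)

Set Implicit Arguments.
Unset Strict Implicit.
Unset Printing Implicit Defensive.

Import GRing.Theory.
Local Open Scope ring_scope.

(** * Reduction of multiplicativity to the basis *)

Lemma alg_hom_linext (A : algType rat) (F : Perm -> A) :
  F [Perm (1 : 'S_0)%g] = 1 ->
  (forall p q, F p * F q = \sum_(r in std_concat p q) F [Perm r]) ->
  alg_hom (linext F).
Proof.
move=> F1 FM; split; first exact: linext_is_linear.
split; first by rewrite /GRing.one /= linextG.
move=> f g; rewrite (_ : f * g = fqsym_mul f g) // unlock.
rewrite [X in linext F X]/linext linear_sum /=.
rewrite [linext F f]/linext mulr_suml; apply: eq_bigr => p _.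
rewrite linearZ /= -scalerAl; congr (_ *: _).
rewrite [X in linext F X]/linext linear_sum /=.
rewrite [linext F g]/linext mulr_sumr; apply: eq_bigr => q _.
rewrite linearZ /= -scalerAr; congr (_ *: _).
rewrite FM linear_sum /=; apply: eq_bigr => r _.
by rewrite linextG.
Qed.

(** * Words over a signed alphabet *)

Section SuperWords.
Variables (N : nat) (pos : nat -> bool).
Local Notation sword n := {ffun 'I_n -> 'I_N}.

Definition slt n (w : sword n) (i j : 'I_n) : bool :=
  (w i < w j)%N || (w i == w j) && (if pos (w i) then i < j else j < i)%N.

Lemma slt_irr n (w : sword n) i : slt w i i = false.
Proof. by rewrite /slt !ltnn if_same andbF. Qed.

Lemma slt_trans n (w : sword n) : transitive (slt w).
Proof.
move=> j i k; rewrite /slt.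
case/orP=> [lt1|/andP [/eqP e1 lt1]]; case/orP=> [lt2|/andP [/eqP e2 lt2]].
- by rewrite (ltn_trans lt1 lt2).
- by rewrite -e2 lt1.
- by rewrite e1 lt2.
- rewrite e1 e2 eqxx ltnn /=; move: lt1 lt2; rewrite e1 e2.
  by case: ifP => _ lt1 lt2; [apply: ltn_trans lt2 | apply: ltn_trans lt1].
Qed.

(* Breaking ties by position makes the letters distinct, so that plain
   standardization applies. *)
Definition scode n (w : sword n) : seq nat :=
  [seq (w i * n.+1 + (if pos (w i) then nat_of_ord i else n - i))%N
     | i <- enum 'I_n].

Definition sstd n (w : sword n) : 'S_n := std_perm n (scode w).

(** The tie-breaking summand is at most [n], so as a last digit in base [n.+1] it never outweighs a
    difference of letters. *)
Lemma letter_lt_scode n (w : sword n) (i j : 'I_n) :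
  letter_lt (scode w) i j = slt w i j.
Proof.
have nthE (k : 'I_n) : nth 0%N (scode w) k =
    (w k * n.+1 + (if pos (w k) then nat_of_ord k else n - k))%N.
  by rewrite (nth_map k) ?size_enum_ord ?nth_ord_enum.
rewrite /letter_lt !nthE /slt.
rewrite -(inj_eq val_inj) /=.
have := ltn_ord i; have := ltn_ord j.
have le_tie (b : bool) k : (k < n)%N -> ((if b then k else n - k) <= n)%N.
  by case: b; lia.
move=> ltj lti; have ti := le_tie (pos (w i)) _ lti.
have tj := le_tie (pos (w j)) _ ltj.
case: (ltngtP (w i) (w j)) => [ltw|ltw|eqw] /=.
- by apply/orP; left; nia.
- by apply/norP; split; [|apply/nandP; left]; nia.
by rewrite eqw; case: ifP => _; apply/idP/idP; lia.
Qed.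

Lemma sstdP n (w : sword n) (p : 'S_n) :
  reflect (forall i j, (p i < p j)%N = slt w i j) (sstd w == p).
Proof.
apply: (iffP eqP) => [<- i j|slt_p].
  by rewrite -letter_lt_word letter_lt_std letter_lt_scode.
rewrite -[RHS]std_perm_word; apply: eq_std_perm => i j.
by rewrite letter_lt_scode letter_lt_word slt_p.
Qed.

Definition scat m n (u : sword m) (v : sword n) : sword (m + n) :=
  [ffun i => match split i with inl j => u j | inr j => v j end].

Lemma scatl m n (u : sword m) (v : sword n) i : scat u v (lshift n i) = u i.
Proof. by rewrite ffunE (unsplitK (inl i)). Qed.

Lemma scatr m n (u : sword m) (v : sword n) i : scat u v (rshift m i) = v i.
Proof. by rewrite ffunE (unsplitK (inr i)). Qed.

(** Comparing two positions depends only on their letters and their relative order, and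
    concatenation preserves both. *)
Lemma sstd_scat (p q : Perm) (u : sword (tag p)) (v : sword (tag q)) :
  (sstd (scat u v) \in std_concat p q)
  = (sstd u == tagged p) && (sstd v == tagged q).
Proof.
case: p q u v => m p [n q] /= u v; rewrite inE /=.
rewrite (@std_size m) ?size_takel ?size_word ?leq_addr //.
rewrite (@std_size n) ?size_drop ?size_word ?addKn //.
rewrite !eq_Tagged /=; congr (_ && _); congr eq_op;
  apply: eq_std_perm => i j.
  transitivity (letter_lt (word (sstd (scat u v))) (lshift n i) (lshift n j)).
    by rewrite /letter_lt !nth_take.
  by rewrite letter_lt_std !letter_lt_scode /slt !scatl.
transitivity (letter_lt (word (sstd (scat u v))) (rshift m i) (rshift m j)).
  by rewrite /letter_lt !nth_drop /= ltn_add2l.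
by rewrite letter_lt_std !letter_lt_scode /slt !scatr /= !ltn_add2l.
Qed.

Variables (R : comNzRingType) (wt : nat -> R).

Definition wsum (p : Perm) : R :=
  \sum_(w : sword (tag p) | sstd w == tagged p) \prod_i wt (w i).

Lemma wsum1 (p : Perm) : tag p = 0%N -> wsum p = 1.
Proof.
case: p => n p /= n0; subst n; rewrite /wsum /=.
have u0 (w : sword 0) : w = ffun0 (card_ord 0) by apply/ffunP => -[].
rewrite (big_pred1 (ffun0 (card_ord 0))) ?big_ord0 // => w.
rewrite /= [w]u0 eqxx; apply/eqP/permP => -[] //.
Qed.

(** Cutting a word after [tag p] letters is a bijection onto pairs of words, and weights
    multiply. *)
Lemma wsumM (p q : Perm) :
  wsum p * wsum q = \sum_(r in std_concat p q) wsum [Perm r].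
Proof.
transitivity (\sum_(w : sword (tag p + tag q) | sstd w \in std_concat p q)
                \prod_i wt (w i)); last first.
  rewrite (partition_big (@sstd _) [in std_concat p q]) //=.
  apply: eq_bigr => r r_pq; apply: eq_bigl => w.
  by case: eqP => [->|]; rewrite ?andbF // r_pq.
rewrite /wsum.
pose h (uv : sword (tag p) * sword (tag q)) := scat uv.1 uv.2.
have h_bij : bijective h.
  exists (fun w : sword (tag p + tag q) =>
    ([ffun i => w (lshift _ i)], [ffun i => w (rshift _ i)])).
    by case=> u v; congr pair; apply/ffunP=> i; rewrite !ffunE ?scatl ?scatr
      ?(unsplitK (inl i)) ?(unsplitK (inr i)).
  move=> w; apply/ffunP => i; rewrite ffunE.
  by case: split_ordP => j ->; rewrite ffunE.
rewrite [RHS](reindex h) /=; last exact: onW_bij.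
rewrite (eq_bigl _ _ (fun uv => sstd_scat uv.1 uv.2)).
rewrite big_distrl /=; under eq_bigr do rewrite big_distrr /=.
rewrite (pair_big (fun u => sstd u == tagged p)
  (fun v => sstd v == tagged q)) /=.
apply: eq_bigr => -[u v] _; rewrite big_split_ord /=.
by congr (_ * _); apply: eq_bigr => i _; rewrite ?scatl ?scatr.
Qed.

(** * Words as chains of letters *)

Definition step_ok (d : bool) (a b : nat) : bool :=
  (a < b)%N || (a == b) && (pos a != d).

Lemma step_ok_slt n (w : sword n.+1) (r : 'S_n.+1) (i : 'I_n) :
  step_ok (is_des r i.+1) (w (r (widen_ord (leqnSn n) i))) (w (r (lift ord0 i)))
  = slt w (r (widen_ord (leqnSn n) i)) (r (lift ord0 i)).
Proof.
rewrite /step_ok /slt /is_des /letter /=.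
rewrite -[X in nth _ _ X]/(nat_of_ord (lift ord0 i)) nth_word.
rewrite -[X in (_ < nth _ _ X)%N]/(nat_of_ord (widen_ord (leqnSn n) i)).
rewrite nth_word ltnS.
have : r (widen_ord (leqnSn n) i) != r (lift ord0 i).
  by rewrite (inj_eq perm_inj) -(inj_eq val_inj) /= /bump /= neq_ltn ltnSn.
rewrite -val_eqE /= => neq; congr (_ || _ && _).
by case: (pos _); move: neq; case: ltngtP.
Qed.

(** [sstd w] is [p] exactly if [p^-1] lists the positions in increasing [slt] order; transitivity
    leaves only consecutive ones to check. *)
Lemma sstd_chain n (w : sword n.+1) (p : 'S_n.+1) :
  (sstd w == p) = \big[andb/true]_(i < n)
    step_ok (is_des p^-1%g i.+1) (w (p^-1%g (widen_ord (leqnSn n) i)))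
      (w (p^-1%g (lift ord0 i))).
Proof.
under eq_bigr do rewrite step_ok_slt.
rewrite big_andE; apply/sstdP/forallP => [slt_p i|step].
  by rewrite -slt_p !permKV /= /bump.
pose lt i j := slt w (p^-1%g i) (p^-1%g j).
(* Induction on the distance [k.+1] of the two positions. *)
have ltS k (i j : 'I_n.+1) : j = (i + k).+1 :> nat -> lt i j.
  elim: k j => [|k IHk] j.
    rewrite addn0 => ji; have i_n : (i < n)%N by rewrite -ltnS -ji.
    have := step (Ordinal i_n); congr (lt _ _); apply: val_inj => //=.
  rewrite addnS => ji; have j'_n : ((i + k).+1 < n)%N by rewrite -ltnS -ji.
  have := step (Ordinal j'_n) => stepj.
  apply: slt_trans (IHk (widen_ord (leqnSn n) (Ordinal j'_n)) erefl) _.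
  by move: stepj; congr (lt _ _); apply: val_inj.
have mono (i j : 'I_n.+1) : (i < j)%N -> lt i j.
  by move=> ltij; apply: (ltS (j - i.+1)%N); rewrite -addSn subnKC.
move=> i j; have -> : slt w i j = lt (p i) (p j) by rewrite /lt !permK.
move: (p i) (p j) => {}i {}j.
case: ltngtP => [/mono -> //|/mono|/val_inj ->]; last by rewrite /lt slt_irr.
by move=> ltji; apply/esym/negP => /(slt_trans ltji); rewrite slt_irr.
Qed.

(** Weighted sum of the chains of [n.+1] letters ending in [b], where [D i] marks a descent at step
    [i]. It does not involve the alphabet size [N], so it has a generating series in [b]. *)
Fixpoint lastsum (D : nat -> bool) n (b : nat) : R :=
  if n is n'.+1 then
    wt b * (\sum_(a < b) lastsum D n' a
            + (if pos b != D n' then lastsum D n' b else 0))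
  else wt b.

Lemma chain_sum (D : nat -> bool) n (b : 'I_N) :
  \sum_(f : sword n.+1 | (\big[andb/true]_(i < n)
        step_ok (D i) (f (widen_ord (leqnSn n) i)) (f (lift ord0 i)))
        && (f ord_max == b)) \prod_i wt (f i)
  = lastsum D n b.
Proof.
elim: n b => [|n IHn] b.
  rewrite (big_pred1 [ffun=> b]) ?big_ord1 ?ffunE // => f.
  rewrite big_ord0 /=; apply/eqP/eqP => [fb|->]; last by rewrite ffunE.
  by apply/ffunP => i; rewrite ffunE -fb ord1 [ord_max]ord1.
have widen_lift m (j : 'I_m) : widen_ord (leqnSn m) j = lift ord_max j.
  by apply: val_inj; rewrite /= /bump leqNgt ltn_ord.
(* [h] appends the last letter [b] and [h'] deletes the last letter; chains are then grouped by
   their last letter but one. *)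
pose h (g : sword n.+1) : sword n.+2 :=
  [ffun i => if unlift ord_max i is Some j then g j else b].
pose h' (f : sword n.+2) : sword n.+1 :=
  [ffun j => f (widen_ord (leqnSn _) j)].
have hl g j : h g (widen_ord (leqnSn _) j) = g j.
  by rewrite ffunE widen_lift liftK.
have hm g : h g ord_max = b by rewrite ffunE unlift_none.
rewrite (reindex_onto h h') /=; last first.
  move=> f /andP [_ /eqP fb]; apply/ffunP => i.
  case: (unliftP ord_max i) => [j|] ->; last by rewrite hm.
  by rewrite -widen_lift hl ffunE.
transitivity (\sum_(a : 'I_N | step_ok (D n) a b) lastsum D n a * wt b).
  under [RHS]eq_bigr do rewrite -IHn big_distrl /=.
  rewrite (partition_big (fun g : sword n.+1 => g ord_max)
    (fun a : 'I_N => step_ok (D n) a b)) /=; last first.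
    move=> g /andP [/andP [+ _] _]; rewrite big_ord_recr /= hl => /andP [_].
    by rewrite (_ : lift ord0 ord_max = ord_max) ?hm //; apply: val_inj.
  apply: eq_bigr => a ok_a; apply: eq_big => g.
    rewrite hm eqxx andbT big_ord_recr /= hl.
    rewrite (_ : lift ord0 ord_max = ord_max) ?hm; last exact: val_inj.
    rewrite (_ : h' _ == g) ?andbT; last first.
      by apply/eqP/ffunP => j; rewrite ffunE hl.
    case: eqP => [->|]; rewrite ?andbF // ok_a !andbT.
    apply: eq_bigr => j _; rewrite hl.
    by rewrite (_ : lift ord0 _ = widen_ord (leqnSn _) (lift ord0 j)) ?hl //;
      apply: val_inj.
  move=> _; rewrite big_ord_recr /= hm; congr (_ * _).
  by apply: eq_bigr => j _; rewrite hl.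
rewrite -big_distrl /= mulrC; congr (_ * _).
transitivity (\sum_(a : 'I_N) ((if (a < b)%N then lastsum D n a else 0)
  + (if a == b then if pos b != D n then lastsum D n b else 0 else 0))).
  rewrite big_mkcond /=; apply: eq_bigr => a _; rewrite /step_ok -val_eqE /=.
  by case: ltngtP => [_|_|->]; rewrite /= ?addr0 ?add0r.
rewrite big_split /= -!big_mkcond big_pred1_eq; congr (_ + _).
exact: (big_ord_narrow (ltnW (ltn_ord b))).
Qed.

Lemma wsum_lastsum n (p : 'S_n.+1) :
  wsum [Perm p] = \sum_(b < N) lastsum (fun i => is_des p^-1%g i.+1) n b.
Proof.
set D := fun i => _; under [RHS]eq_bigr do rewrite -chain_sum.
rewrite -(partition_big _ xpredT) //=.
rewrite /wsum /= (reindex (fun f : sword n.+1 => [ffun i => f (p i)])) /=.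
  apply: eq_big => [f|f _].
    rewrite sstd_chain; apply: eq_bigr => i _.
    by rewrite !ffunE !permKV.
  rewrite [RHS](reindex_inj (@perm_inj _ p)) /=.
  by apply: eq_bigr => i _; rewrite ffunE.
apply: onW_bij; exists (fun f : sword n.+1 => [ffun i => f (p^-1%g i)]) => f;
  by apply/ffunP => i; rewrite !ffunE ?permK ?permKV.
Qed.
End SuperWords.

Lemma wsum_scale N pos (R : comNzRingType) (c : R) wt (p : Perm) :
  wsum N pos (fun a => c * wt a) p = c ^+ tag p * wsum N pos wt p.
Proof.
rewrite /wsum big_distrr; apply: eq_bigr => w _ /=.
by rewrite big_split /= prodr_const card_ord.
Qed.

(** * Partial sums and substitutions of power series *)

Section FpsOperations.
Variable R : comUnitRingType.
Implicit Types (f g : fps R) (c : R).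
Local Notation t := (fpsX R).

Lemma coefsCM c f n : coefs (fpsC c * f) n = c * coefs f n.
Proof.
by rewrite coefsM big_ord_recl /= subn0 big1 ?addr0 // => i _; rewrite mul0r.
Qed.

Lemma coefsXM f n : coefs (t * f) n = if n is n'.+1 then coefs f n' else 0.
Proof.
rewrite coefsM; case: n => [|n]; first by rewrite big_ord1 mul0r.
rewrite 2!big_ord_recl /= mul0r add0r mul1r subSS subn0 big1 ?addr0 // => i _.
by rewrite mul0r.
Qed.

Lemma fpsCM c d : fpsC (c * d) = fpsC c * fpsC d.
Proof. by apply: fpsP => -[|n]; rewrite coefsCM ?mulr0. Qed.

Lemma fpsCX c n : fpsC (c ^+ n) = fpsC c ^+ n.
Proof. by elim: n => // n IHn; rewrite !exprS fpsCM IHn. Qed.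

Lemma unit_1subXM f : 1 - t * f \is a GRing.unit.
Proof.
rewrite -[_ \is a _]/(coefs (1 - t * f) 0 \is a GRing.unit).
by rewrite coefsB coefs0M mul0r subr0 unitr1.
Qed.

Lemma unit_1subX : 1 - t \is a GRing.unit.
Proof. by rewrite -[t]mulr1 unit_1subXM. Qed.

Definition psums f : fps R := Fps (fun k => \sum_(a < k) coefs f a).

Lemma psumsE f : (1 - t) * psums f = t * f.
Proof.
apply: fpsP => -[|n]; rewrite mulrBl mul1r coefsB !coefsXM /=.
  by rewrite big_ord0 subr0.
by rewrite big_ord_recr /= addrAC subrr add0r.
Qed.

(** Substitution of [c * t] for [t]; it accounts for the weight [q ^+ b] of a new last letter
    [b]. *)
Definition dilate c f : fps R := Fps (fun k => c ^+ k * coefs f k).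

Lemma coefs_dilate c f n : coefs (dilate c f) n = c ^+ n * coefs f n.
Proof. by []. Qed.

Lemma dilateM c f g : dilate c (f * g) = dilate c f * dilate c g.
Proof.
apply: fpsP => n; rewrite coefs_dilate !coefsM big_distrr.
apply: eq_bigr => i _ /=.
by rewrite mulrACA -exprD subnKC // -ltnS.
Qed.

Lemma dilate1 c : dilate c 1 = 1.
Proof. by apply: fpsP => -[|n] /=; rewrite ?mulr1 ?mulr0. Qed.

Lemma dilateXn c f n : dilate c (f ^+ n) = dilate c f ^+ n.
Proof. by elim: n => [|n IHn]; rewrite ?dilate1 // !exprS dilateM IHn. Qed.

Lemma dilateB c f g : dilate c (f - g) = dilate c f - dilate c g.
Proof. by apply: fpsP => n; rewrite coefsB !coefs_dilate coefsB mulrBr. Qed.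

Lemma dilateC c d : dilate c (fpsC d) = fpsC d.
Proof. by apply: fpsP => -[|n] /=; rewrite ?mul1r ?mulr0. Qed.

Lemma dilateX c : dilate c t = t * fpsC c.
Proof.
apply: fpsP => n; rewrite coefsXM; case: n => [|[|n]] /=; rewrite ?mulr0 //.
by rewrite mulr1.
Qed.
End FpsOperations.

(** * Generating series for (ides, icomaj) *)

Section DesComajSeries.
Variables (R : comUnitRingType) (q : R) (D : nat -> bool).
Local Notation t := (fpsX R).
Local Notation qC := (fpsC q).
Let last n := lastsum xpredT (fun a => q ^+ a) D n.

(** Substituting [q t] for [t] shifts the factors already present to [i >= 2] and turns the new
    [1 - t] into the factor for [i = 1]. *)
Lemma lastsum_des_comaj n :
  Fps (last n) * \prod_(1 <= i < n.+2) (1 - t * qC ^+ i)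
  = t ^+ (\sum_(i < n | D i) 1) * qC ^+ (\sum_(i < n | D i) (n - i)).
Proof.
elim: n => [|n IHn].
  rewrite !big_ord0 !expr0 mul1r big_nat1 expr1; apply: fpsP => n.
  rewrite mulrBr mulr1 mulrA [_ * t]mulrC -mulrA [_ * qC]mulrC coefsB coefsXM.
  rewrite coefs1; case: n => [|n]; first by rewrite subr0.
  by rewrite coefsCM /last /= exprS subrr.
have step : (1 - t) * Fps (fun b => \sum_(a < b) last n a
    + (if true != D n then last n b else 0)) = t ^+ (D n) * Fps (last n).
  rewrite (_ : Fps _ =
      psums (Fps (last n)) + (if D n then 0 else Fps (last n))).
    rewrite mulrDr psumsE; case: (D n); first by rewrite mulr0 addr0 expr1.
    by rewrite expr0 mulrBl addrC subrK.
  by apply: fpsP => b; rewrite coefsD; case: (D n).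
have -> : Fps (last n.+1) = dilate q (Fps (fun b => \sum_(a < b) last n a
    + (if true != D n then last n b else 0))) by [].
rewrite big_ltn // big_add1 /=.
have -> : \prod_(1 <= i < n.+2) (1 - t * qC ^+ i.+1)
        = dilate q (\prod_(1 <= i < n.+2) (1 - t * qC ^+ i)).
  rewrite (big_morph _ (dilateM q) (dilate1 q)); apply: eq_bigr => i _.
  by rewrite dilateB dilateM dilate1 dilateXn dilateC dilateX exprS mulrA.
rewrite mulrA [_ * (1 - _)]mulrC.
have -> : 1 - t * qC ^+ 1 = dilate q (1 - t).
  by rewrite dilateB dilate1 dilateX.
rewrite -dilateM step -dilateM -mulrA IHn !dilateM !dilateXn dilateX dilateC.
rewrite !(big_mkcond (fun i : 'I__ => D i)) !big_ord_recr /= subSnn.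
(* The substitution gains one power of [q] per descent, as [n - i] becomes [n.+1 - i]. *)
have -> : (\sum_(i < n) (if D i then n.+1 - i else 0)
  = \sum_(i < n) (if D i then n - i else 0)
    + \sum_(i < n) (if D i then 1 else 0))%N.
  rewrite -big_split /=; apply: eq_bigr => i _; case: ifP => // _.
  by rewrite subSn ?addn1 // ltnW.
set A := (\sum_(i < n) _)%N; set B := (\sum_(i < n) _)%N.
by case: (D n); rewrite ?addn0 ?expr0 ?exprMn !exprD ?expr1; ring.
Qed.

(** Summing over the last letter [a < k] multiplies by [t / (1 - t)], which gives the factor for
    [i = 0] and one more [t]. *)
Lemma psums_des_comaj n :
  psums (Fps (last n)) * \prod_(0 <= i < n.+2) (1 - t * qC ^+ i)
  = t ^+ (\sum_(i < n | D i) 1).+1 * qC ^+ (\sum_(i < n | D i) (n - i)).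
Proof.
rewrite big_ltn // expr0 mulr1 mulrA [_ * (1 - t)]mulrC psumsE.
by rewrite -mulrA lastsum_des_comaj exprS mulrA.
Qed.
End DesComajSeries.

(** * Generating series for the peak statistics *)

(* The letters 0, 1, 2, 3, 4, ... stand for 0 < -1 < 1 < -2 < 2 < ...; the
   letter 0 is left out, by giving it weight 0, if [e0] holds. The resulting series behave as if the
   position before the first one was a descent if [e0] holds, an ascent
   otherwise. *)
Section PeakSeries.
Variables (R : comUnitRingType) (e0 : bool) (D : nat -> bool).
Local Notation t := (fpsX R).
Let wt a : R := (~~ e0 || (a != 0%N))%:R.
Let last n := lastsum (fun a => ~~ odd a) wt D n.
Let e n := if n is n'.+1 then D n' else e0.
(** Indexed by absolute value: the letter 2k is k and the letter 2k - 1 is -k. There is no -0, hence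
    the zero constant term of [odds]. *)
Let evens n : fps R := Fps (fun k => last n k.*2).
Let odds n : fps R := Fps (fun k => if k is k'.+1 then last n k'.*2.+1 else 0).
Let total n : fps R := Fps (fun k => \sum_(a < k.*2.+1) last n a).

Let lastS n b : last n.+1 b =
  \sum_(a < b) last n a + (if (~~ odd b) != D n then last n b else 0).
Proof.
transitivity (wt b * (\sum_(a < b) last n a
                      + (if (~~ odd b) != D n then last n b else 0))) => //.
rewrite /wt; case: (boolP (_ || _)) => [_|]; first by rewrite mul1r.
rewrite negb_or !negbK => /andP [e0T /eqP ->]; rewrite mul0r big_ord0 add0r.
case: ifP => // _; rewrite /last /wt.
by case: (n) => [|m] /=; rewrite e0T //= mul0r.
Qed.

Let totalE n : (1 - t) * total n = odds n + evens n.
Proof.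
apply: fpsP => -[|k]; rewrite mulrBl mul1r coefsB coefsXM coefsD /=.
  by rewrite big_ord1 subr0 add0r.
by rewrite 2!big_ord_recr /= -addrA addrAC subrr add0r.
Qed.

Let evensS n : evens n.+1 = total n - (if D n then evens n else 0).
Proof.
apply: fpsP => k; rewrite coefsB /= lastS odd_double big_ord_recr /=.
by case: (D n); rewrite /= ?addr0 ?addrK ?subr0.
Qed.

Let oddsS n : odds n.+1 = t * total n + (if D n then odds n else 0).
Proof.
apply: fpsP => -[|k]; rewrite coefsD coefsXM /=.
  by case: (D n); rewrite add0r.
by rewrite lastS /= odd_double /=; case: (D n).
Qed.

(** At a descent the same letters may precede -k and k; at an ascent those before -k are those
    before k - 1. So [evens] determines both series. *)
Let oddsE n : odds n = if e n then evens n else t * evens n.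
Proof.
case: n => [|n] /=.
  case: ifP => e0E; apply: fpsP => -[|k]; rewrite ?coefsXM //=.
    by rewrite /last /= /wt e0E.
  by rewrite /last /= /wt e0E.
rewrite oddsS evensS; case: (D n); last by rewrite subr0 addr0.
have -> : evens n = (1 - t) * total n - odds n.
  by rewrite totalE addrAC subrr add0r.
by ring.
Qed.

Let trans a b : fps R :=
  if a then (if b then 1 + t else 2) else (if b then 2 * t else 1 + t).

Let evens0 : (1 - t) * evens 0 = t ^+ e0.
Proof.
apply: fpsP => -[|k]; rewrite mulrBl mul1r coefsB coefsXM /= /last /= /wt.
  by case: (e0); rewrite /= subr0.
by rewrite orbT; case: (e0); case: k => [|k]; rewrite /= ?subr0 ?subrr.
Qed.

Let evens_step n : (1 - t) * evens n.+1 = trans (e n) (e n.+1) * evens n.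
Proof.
rewrite evensS mulrBr totalE oddsE /trans /=.
by case: (D n); case: (e n); rewrite ?mulr0 ?subr0; ring.
Qed.

(** Summing over all last letters amounts to a further ascent, hence the final factor
    [trans (e n) false]. *)
Let total_trans n : total n * (1 - t) ^+ n.+2
  = t ^+ e0 * \prod_(i < n) trans (e i) (e i.+1) * trans (e n) false.
Proof.
have evensE : evens n * (1 - t) ^+ n.+1
  = t ^+ e0 * \prod_(i < n) trans (e i) (e i.+1).
  elim: n => [|n IHn]; first by rewrite big_ord0 mulr1 mulrC evens0.
  by rewrite exprS mulrA [_ * (1 - t)]mulrC evens_step big_ord_recr /= mulrA
    -IHn -mulrA mulrC.
rewrite exprS mulrA [_ * (1 - t)]mulrC totalE -evensE oddsE /trans.
by case: (e n); ring.
Qed.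

(* The word [e 0, ..., e n, false] has as many rises [false, true] as falls
   [true, false], up to [e0]. *)
Lemma total_peaks n (c := (\sum_(i < n | ~~ e i && e i.+1) 1 + e0)%N)
    (d := (2 * \sum_(i < n | ~~ e i && e i.+1) 1 + e0)%N) :
  total n * (1 - t) ^+ n.+2 = 2 ^+ d * t ^+ c * (1 + t) ^+ (n.+1 - d).
Proof.
rewrite total_trans {}/c {}/d.
(* [k] counts the changes in [e 0, ..., e n], each giving a factor 2, and [r] the steps without
   change. *)
suff [k [r [e_k n_kr ->]]] : exists k r,
    [/\ (k + e n = 2 * \sum_(i < n | ~~ e i && e i.+1) 1 + e0)%N,
        n = (k + r)%N &
        \prod_(i < n) trans (e i) (e i.+1) =
        2 ^+ k * t ^+ (\sum_(i < n | ~~ e i && e i.+1) 1) * (1 + t) ^+ r].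
  set p := (\sum_(i < n | _) 1)%N in e_k *; rewrite /trans (exprD t).
  case: (e n) e_k => /= e_k.
    have -> : (n.+1 - (2 * p + e0) = r)%N by lia.
    rewrite -e_k addn1.
    by rewrite exprS; ring.
  have -> : (n.+1 - (2 * p + e0) = r.+1)%N by lia.
  rewrite -e_k addn0.
  by rewrite [in RHS]exprS; ring.
elim: n => [|n [k [r [e_k n_kr W]]]].
  by exists 0%N, 0%N; rewrite !big_ord0 !expr0 !mulr1.
rewrite !(big_mkcond (fun i : 'I__ => ~~ e i && e i.+1)) !big_ord_recr /=.
rewrite -!(big_mkcond (fun i : 'I__ => ~~ e i && e i.+1)) /= {}W.
rewrite -[D n]/(e n.+1).
move: e_k; rewrite /trans; set c := (\sum_(i < n | _) 1)%N.
case: (e n); case: (e n.+1) => /= e_k; rewrite ?addn0.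
- exists k, r.+1; split; [by lia | by lia |].
  by rewrite [in RHS]exprS mulrA [RHS]mulrAC.
- exists k.+1, r; split; [by lia | by lia |].
  by rewrite [in RHS]exprS; ring.
- exists k.+1, r; split; [by lia | by lia |].
  by rewrite addn1 ![in RHS]exprS; ring.
- exists k, r.+1; split; [by lia | by lia |].
  by rewrite [in RHS]exprS; ring.
Qed.
End PeakSeries.

(** * Statistics in terms of the descent set *)

Lemma desE n (r : 'S_n.+1) :
  des r = (\sum_(i < n | is_des r i.+1) 1)%N.
Proof. by rewrite /des big_add1 big_mkord. Qed.

Lemma comajE n (r : 'S_n.+1) :
  comaj r = (\sum_(i < n | is_des r i.+1) (n - i))%N.
Proof. by rewrite /comaj big_add1 big_mkord. Qed.

Lemma is_peak_des n (r : 'S_n) i : (i.+1 < n)%N ->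
  is_peak r i.+2 = ~~ is_des r i.+1 && is_des r i.+2.
Proof.
move=> lt_in; rewrite /is_peak /is_des /letter /=; congr (_ && _).
have := nth_word r (Ordinal (ltnW lt_in)); have := nth_word r (Ordinal lt_in).
move=> /= -> ->; rewrite !ltnS.
have : r (Ordinal (ltnW lt_in)) != r (Ordinal lt_in).
  by rewrite (inj_eq perm_inj) -val_eqE /= neq_ltn ltnSn.
by rewrite -val_eqE /=; case: ltngtP.
Qed.

(** With [e0] false, a descent at the first position is a rise and gives the extra term of [lpk];
    with [e0] true it cannot be a rise. *)
Lemma sum_peaks n (r : 'S_n.+1) (e0 : bool) (D := fun i => is_des r i.+1)
    (e := fun i => if i is i'.+1 then D i' else e0) :
  (\sum_(i < n | ~~ e i && e i.+1) 1 = if e0 then pk r else lpk r)%N.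
Proof.
rewrite /lpk /pk; case: n r @D @e => [|n] r D e.
  by rewrite big_ord0 big_geq //= if_same.
rewrite (_ : \sum_(2 <= i < n.+2 | is_peak r i) 1
           = \sum_(i < n | ~~ D i && D i.+1) 1)%N; last first.
  rewrite 2!big_add1 big_mkord /=; apply: eq_bigl => i.
  by rewrite is_peak_des ?ltnS // ltnW.
rewrite big_mkcond big_ord_recl -big_mkcond /=; case: (e0) => //=.
by rewrite addnC -[is_des r 1]/(D 0%N); case: (D 0%N).
Qed.

(** * The three homomorphisms *)

Lemma alg_hom_wsum (R : comAlgType rat) (F : Perm -> hps R)
    (N : nat -> nat) (pos : nat -> bool) (wt : nat -> R) :
  (forall p k, coefs (fps_of (F p)) k = wsum (N k) pos wt p) ->
  alg_hom (linext F).
Proof.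
move=> FE; have coefs_sum (I : finType) (P : pred I) (f : I -> hps R) k :
    coefs (fps_of (\sum_(i | P i) f i)) k
    = \sum_(i | P i) coefs (fps_of (f i)) k.
  by elim/big_rec2: _ => // i _ y _ <-.
(* The product is coefficientwise, so each power of [t] may use its own alphabet size [N k]. *)
apply: alg_hom_linext => [|p q]; apply: hpsP => k.
  by rewrite FE wsum1.
by rewrite coefs_sum /= !FE wsumM; apply: eq_bigr => r _; rewrite FE.
Qed.

Lemma coefs_inv_1subX (R : comUnitRingType) k :
  coefs (1 - fpsX R)^-1 k = 1.
Proof.
by have /(congr1 (fun f => coefs (fps_of f) k)) /= <- := hps_oneE R.
Qed.

Lemma coefs_div_mulXn (R : comUnitRingType) (f g : fps R) (h : nat -> R)
    (c : R) n k :
  Fps h * g = f -> g \is a GRing.unit ->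
  coefs (f / g * fpsC c ^+ n) k = c ^+ n * h k.
Proof. by move=> <- Ug; rewrite mulrK // -fpsCX mulrC coefsCM. Qed.

#[local] Arguments coefs : simpl never.

Lemma alg_hom_ides_icomaj : alg_hom Psi_ides_icomaj.
Proof.
apply: (alg_hom_wsum (N := id) (pos := xpredT)
  (wt := fun a => fpsC (fpsX rat^o : Qx) * fpsX Qx ^+ a)) => -[[|n] p] k /=.
  by rewrite wsum1 //; apply: coefs_inv_1subX.
pose D i := is_des p^-1%g i.+1.
rewrite wsum_scale wsum_lastsum /ides /icomaj desE comajE.
have := psums_des_comaj (fpsX Qx : Qqx) D n.
move=> /(coefs_div_mulXn (fpsC (fpsX rat^o : Qx) : Qqx) n.+1 k); apply.
by apply: rpred_prod => i _; apply: unit_1subXM.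
Qed.

Lemma alg_hom_ipk : alg_hom Psi_ipk.
Proof.
(* The letters are 0, ..., 2k; giving the letter 0 weight 0 is the case [e0 = true]. *)
apply: (alg_hom_wsum (N := fun k => k.*2.+1) (pos := fun a => ~~ odd a)
  (wt := fun a => (fpsX rat^o : Qx) * (~~ true || (a != 0%N))%:R))
  => -[[|n] p] k /=.
  by rewrite wsum1 //; apply: coefs_inv_1subX.
pose D i := is_des p^-1%g i.+1.
rewrite wsum_scale wsum_lastsum /ipk -subnDA -(sum_peaks p^-1%g true).
have := total_peaks Qx true D n.
move=> /(coefs_div_mulXn (fpsX rat^o : Qx) n.+1 k); apply.
by rewrite unitrX ?unit_1subX.
Qed.

Lemma alg_hom_ilpk : alg_hom Psi_ilpk.
Proof.
apply: (alg_hom_wsum (N := fun k => k.*2.+1) (pos := fun a => ~~ odd a)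
  (wt := fun a => (fpsX rat^o : Qx) * (~~ false || (a != 0%N))%:R))
  => -[[|n] p] k /=.
  (* For the empty permutation the general formula itself reduces to 1/(1 - t). *)
  rewrite wsum1 // /ilpk /lpk /pk big_geq //=.
  by rewrite !expr0 !mul1r mulr1 coefs_inv_1subX.
pose D i := is_des p^-1%g i.+1.
rewrite wsum_scale wsum_lastsum /ilpk.
have := total_peaks Qx false D n; rewrite (sum_peaks p^-1%g false) !addn0.
move=> /(coefs_div_mulXn (fpsX rat^o : Qx) n.+1 k); apply.
by rewrite unitrX ?unit_1subX.
Qed.

Theorem theorem3p6 :
  [/\ alg_hom Psi_ides_icomaj, alg_hom Psi_ipk & alg_hom Psi_ilpk].
Proof.
split; first exact: alg_hom_ides_icomaj.
  exact: alg_hom_ipk.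
exact: alg_hom_ilpk.
Qed.
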